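(* Let $G$ be a connected finite simple graph, let $M$ be a generalized Laplacian on $G$ with eigenvalues $\lambda_1\le\cdots\le\lambda_n$ (listed with multiplicity, $n=|V_G|$), and suppose that $\lambda_k$ is a simple eigenvalue of $M$. Let $\mathbf f_k$ be an eigenvector of $M$ with eigenvalue $\lambda_k$ such that $\mathrm{Urschel}(\mathbf f_k)=\{v\in V_G:\mathbf f_k(v)=0\}$ is nonempty. Then there are generalized Laplacians $M'$ and $M''$ on $G$ such that the $k$-th eigenvalues of $M'$ and of $M''$ are simple, and there are corresponding eigenvectors $\mathbf f_k'$ (of $M'$) and $\mathbf f_k''$ (of $M''$) for these $k$-th eigenvalues such that: (1) $\mathbf f_k'$ and $\mathbf f_k''$ are each a signing of $\mathbf f_k$, and they are different (i.e. non-equivalent) signings of $\mathbf f_k$; (2) $\mathbf f_k'$ and $\mathbf f_k''$ are nowhere zero, and both have at most $k$ nodal domains. Hence $$\mathrm{UN}_2(\mathbf f_k)\le k .$$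
   Context: Graphs $G=(V_G,E_G)$ are finite and simple. A generalized Laplacian on $G$ is a symmetric real matrix $M\in\mathbb R^{V_G\times V_G}$ such that $M(u,v)=0$ whenever $u\ne v$ and $\{u,v\}\notin E_G$, and $M(u,v)<0$ for all $\{u,v\}\in E_G$. The $k$-th eigenvalue means the $k$-th smallest, counted with multiplicity. For $\mathbf f:V_G\to\mathbb R$, a strong nodal domain of $\mathbf f$ is a connected component of the subgraph of $G$ induced on $\{v:\mathbf f(v)>0\}$ or of the subgraph induced on $\{v:\mathbf f(v)<0\}$; $\mathrm{SND}(\mathbf f)$ is the number of strong nodal domains. For nowhere-zero functions, ''nodal domain'' means strong nodal domain. A signing of $\mathbf f$ is a nowhere-zero function $\tilde{\mathbf f}:V_G\to\mathbb R$ with $\tilde{\mathbf f}(v)>0$ whenever $\mathbf f(v)>0$ and $\tilde{\mathbf f}(v)<0$ whenever $\mathbf f(v)<0$. Two signings are equivalent (regarded as the same) if they have the same sign at every vertex. If $\mathbf f$ vanishes at exactly $\ell$ vertices, there are $2^\ell$ equivalence classes of signings; choose representatives $\tilde{\mathbf f}_1,\ldots,\tilde{\mathbf f}_{2^\ell}$ ordered so that $\mathrm{SND}(\tilde{\mathbf f}_1)\le\cdots\le\mathrm{SND}(\tilde{\mathbf f}_{2^\ell})$. The $i$-th Urschel number of $\mathbf f$ is $\mathrm{UN}_i(\mathbf f)=\mathrm{SND}(\tilde{\mathbf f}_i)$ for $1\le i\le 2^\ell$. *)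

(* Defs.v *)
From HB Require Import structures.
From mathcomp Require Import all_boot all_order all_algebra.
From mathcomp Require Import reals.

Set Implicit Arguments.
Unset Strict Implicit.
Unset Printing Implicit Defensive.

Import Order.TTheory GRing.Theory Num.Theory.
Local Open Scope ring_scope.

(* A simple graph on V is a symmetric irreflexive relation e : rel V. *)

Section Graph.
Variables (V : finType) (e : rel V).

Definition connected_graph : Prop := forall u v : V, connect e u v.

Definition induced (A : {set V}) : rel V :=
  [rel u v | [&& u \in A, v \in A & e u v]].

(* [induced A] leaves the vertices outside A isolated; intersecting with A
   (done by [n_comp]) discards them. *)
Definition num_components (A : {set V}) : nat := n_comp (induced A) A.

End Graph.

Section Definitions.
Variables (R : realType) (V : finType) (e : rel V).
Implicit Types (M : V -> V -> R) (f g : V -> R) (s : seq R).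

Definition generalized_laplacian M : Prop :=
  [/\ forall u v, M u v = M v u,
      forall u v, u != v -> ~~ e u v -> M u v = 0
    & forall u v, e u v -> M u v < 0].

Definition matrix_of M : 'M[R]_#|V| :=
  \matrix_(i, j) M (enum_val i) (enum_val j).

(* s lists the eigenvalues of M in nondecreasing order, with multiplicity. *)
Definition is_spectrum M s : Prop :=
  sorted <=%R s /\ char_poly (matrix_of M) = \prod_(x <- s) ('X - x%:P).

(* 1-based: meant for 1 <= k <= size s. *)
Definition kth_eigenvalue s (k : nat) : R := nth 0 s k.-1.

Definition kth_eigenvalue_simple s (k : nat) : Prop :=
  count_mem (kth_eigenvalue s k) s = 1%N.

Definition eigenvector M (lambda : R) f : Prop :=
  (exists v, f v != 0) /\ forall u, \sum_v M u v * f v = lambda * f u.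

Definition SND f : nat :=
  addn (num_components e [set v | 0 < f v]) (num_components e [set v | f v < 0]).

Definition nowhere_zero f : Prop := forall v, f v != 0.

Definition is_signing f g : Prop :=
  [/\ nowhere_zero g,
      forall v, 0 < f v -> 0 < g v
    & forall v, f v < 0 -> g v < 0].

Definition equiv_signing f g : Prop := forall v, Num.sg (f v) = Num.sg (g v).

Definition Urschel f : {set V} := [set v | f v == 0].

(* The equivalence classes of signings of f are in bijection with the subsets S
   of Urschel f, S being the set of zeros of f that become positive; see
   [canonical_signing_uniq] and [canonical_signing_ex]. *)
Definition canonical_signing f (S : {set V}) : V -> R :=
  fun v => if f v != 0 then f v else if v \in S then 1 else -1.

(* 1-based: meant for 1 <= i <= 2 ^ #|Urschel f|. *)
Definition UN f (i : nat) : nat :=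
  nth 0%N
    (sort leq [seq SND (canonical_signing f A) | A <- enum (powerset (Urschel f))])
    i.-1.

Lemma canonical_signingP f S : is_signing f (canonical_signing f S).
Proof.
rewrite /canonical_signing; split => v.
- case: (boolP (f v != 0)) => // _.
  by case: ifP => _; rewrite ?oppr_eq0 oner_eq0.
- by move=> fv; rewrite gt_eqF.
- by move=> fv; rewrite lt_eqF.
Qed.

Lemma canonical_signing_uniq f (S T : {set V}) :
  S \subset Urschel f -> T \subset Urschel f ->
  equiv_signing (canonical_signing f S) (canonical_signing f T) -> S = T.
Proof.
move=> /subsetP SZ /subsetP TZ eqST; apply/setP => v.
have [fv0|fv0] := boolP (f v == 0); last first.
  by rewrite (contraNF (SZ v)) ?(contraNF (TZ v)) // inE.
have /eqP := eqST v; rewrite /canonical_signing fv0 /=.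
case: (v \in S); case: (v \in T) => //.
- by rewrite sgrN sgr1 gt_eqF // (lt_trans (ltrN10 R) ltr01).
- by rewrite sgrN sgr1 lt_eqF // (lt_trans (ltrN10 R) ltr01).
Qed.

Lemma canonical_signing_ex f g : is_signing f g ->
  exists2 S : {set V}, S \in powerset (Urschel f)
                     & equiv_signing g (canonical_signing f S).
Proof.
move=> [g0 gp gn]; exists [set v in Urschel f | 0 < g v].
  by rewrite powersetE; apply/subsetP => v; rewrite inE => /andP[].
move=> v; rewrite /canonical_signing !inE.
have [fv|fv|fv] := ltgtP (f v) 0; last 1 first.
- have := g0 v; case: ltgtP => // gv _; first by rewrite gtr0_sg // sgr1.
  by rewrite ltr0_sg // sgrN sgr1.
- by rewrite !ltr0_sg // gn.
- by rewrite !gtr0_sg // gp.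
Qed.

Lemma SND_equiv f g : equiv_signing f g -> SND f = SND g.
Proof.
move=> eqfg; rewrite /SND.
have -> : [set v | 0 < f v] = [set v | 0 < g v].
  by apply/setP => v; rewrite !inE -sgr_gt0 eqfg sgr_gt0.
suff -> : [set v | f v < 0] = [set v | g v < 0] by [].
by apply/setP => v; rewrite !inE -sgr_lt0 eqfg sgr_lt0.
Qed.

End Definitions.

(* Main.v *)
Require Import Defs.
From HB Require Import structures.
From mathcomp Require Import all_boot all_order all_algebra.
From mathcomp Require Import spectral lra ring zify.
From mathcomp Require Import reals complex.
Import Order.TTheory GRing.Theory Num.Theory.
Local Open Scope ring_scope.

Set Implicit Arguments.
Unset Strict Implicit.
Unset Printing Implicit Defensive.

(* That lam is the k-th eigenvalue of M and simple follows, once lam is an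
   eigenvalue, from the existence of subspaces of dimensions k - 1 and n - k on
   which the form of M - lam is negative, resp. positive, definite.  Quantified
   by a gap delta, this survives small perturbations of M.

   So it suffices to deform (M, f), keeping M f = lam f exact, until f has no
   zero.  Let b be a zero of f adjacent to the support of f, and let W be the
   set of zeros not adjacent to the support.  After adding a small t to the
   diagonal of M on W, the equation (M - lam) g = 0 on W can be solved with
   g(b) = sigma prescribed and g = 0 off W and b.  Take f' = f + eps g: the
   residual of order eps is cancelled at a zero adjacent to the support by
   changing the weight of an edge to the support, and on the support by changing
   the diagonal.  This makes f' nonzero at b, with the sign of sigma, and does not
   change f on its support; iterate.  The choices sigma = 1 and sigma = -1 in the
   first step give two different signings.

   Courant's theorem holds since the form of M - lam is nonpositive on the span
   of the restrictions of f' to its nodal domains. *)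

(** * Counting eigenvalues with subspaces *)

Section SpectralCounting.
Local Open Scope sesquilinear_scope.
Variable R : rcfType.
Local Notation C := R[i].
Local Notation toC := (real_complex R).

(** The vectors are complex so that the unitary spectral theorem over [R[i]] applies to the real
    matrix [A]. *)
Definition hform n (A : 'M[R]_n) (z : 'rV[C]_n) : C :=
  (z *m map_mx toC A *m z ^t*) 0 0.

Definition sqnorm n (z : 'rV[C]_n) : C := \sum_i `|z 0 i| ^+ 2.

Lemma hformE n (A : 'M[R]_n) z :
  hform A z = \sum_i \sum_j toC (A i j) * (z 0 i * (z 0 j)^*).
Proof.
rewrite /hform mxE exchange_big; apply: eq_bigr => j _.
rewrite !mxE mulr_suml; apply: eq_bigr => i _.
by rewrite !mxE mulrCA mulrA.
Qed.

Lemma sqnorm_gt0 n (z : 'rV[C]_n) : z != 0 -> 0 < sqnorm z.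
Proof.
move=> /rV0Pn[i zi]; rewrite /sqnorm (bigD1 i) //= ltr_wpDr ?exprn_gt0 ?normr_gt0//.
by apply: sumr_ge0 => j _; rewrite exprn_ge0.
Qed.

(** The rows of [P] are orthonormal eigenvectors, and [z *m P ^t*] lists the coordinates of [z]
    along them. *)
Definition diagonalizes n (P : 'M[C]_n) (d : 'rV[R]_n) (A : 'M[R]_n) : Prop :=
  P \is unitarymx /\ map_mx toC A = P ^t* *m diag_mx (map_mx toC d) *m P.

Lemma real_symmetric_spectral n (A : 'M[R]_n) :
  A^T = A -> exists P d, diagonalizes P d A.
Proof.
move=> symA; set B := map_mx toC A.
have Bh : B \is hermsymmx.
  apply: realsym_hermsym.
    by apply/is_hermitianmxP; rewrite expr0 scale1r map_mx_id // map_trmx symA.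
  by apply/mxOverP => i j; rewrite mxE; apply/complex_realP; exists (A i j).
exists (spectralmx B), (map_mx (@complex.Re R) (spectral_diag B)).
split; first exact: spectral_unitarymx.
have -> : map_mx toC (map_mx (@complex.Re R) (spectral_diag B)) = spectral_diag B.
  apply/matrixP => i j; rewrite !mxE RRe_real //.
  exact/mxOverP/hermitian_spectral_diag_real.
rewrite -invmx_unitary ?spectral_unitarymx //.
exact/orthomx_spectralP/hermitian_normalmx.
Qed.

Lemma diagonalizes_char_poly n P d (A : 'M[R]_n) :
  diagonalizes P d A -> char_poly A = \prod_i ('X - (d 0 i)%:P).
Proof.
case=> Pu AE; apply: (@map_poly_inj _ _ toC).
rewrite map_char_poly AE rmorph_prod /=.
rewrite [RHS](_ : _ = char_poly (diag_mx (map_mx toC d))); last first.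
  rewrite char_poly_trig ?diag_mx_is_trig //; apply: eq_bigr => i _.
  by rewrite rmorphB /= map_polyX map_polyC !mxE eqxx.
have PP : P ^t* *m P = 1%:M by apply/mulmx1C/unitarymxP.
set D := diag_mx _; rewrite /char_poly /char_poly_mx.
have -> : 'X%:M - map_mx polyC (P ^t* *m D *m P) =
    map_mx polyC (P^t*) *m ('X%:M - map_mx polyC D) *m map_mx polyC P.
  rewrite mulmxBr mulmxBl -!map_mxM /= mul_mx_scalar -scalemxAl -map_mxM.
  by rewrite PP map_mx1 scalemx1.
rewrite !det_mulmx mulrAC -det_mulmx -map_mxM PP map_mx1 det1 mul1r //.
Qed.

Section Diagonalized.
Variables (n : nat) (P : 'M[C]_n) (d : 'rV[R]_n) (A : 'M[R]_n).
Hypothesis AP : diagonalizes P d A.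

Lemma diagonalizes_hform z :
  hform A z = \sum_i toC (d 0 i) * `|(z *m P ^t*) 0 i| ^+ 2.
Proof.
case: AP => Pu AE; rewrite /hform AE !mulmxA -[_ *m P *m _]mulmxA.
have -> : P *m z ^t* = (z *m P ^t*) ^t*.
  by rewrite trmx_mul map_mxM /= trmxCK.
rewrite mxE; apply: eq_bigr => i _.
by rewrite mul_mx_diag !mxE normCK mulrAC mulrC.
Qed.

Lemma diagonalizes_sqnorm z : sqnorm z = \sum_i `|(z *m P ^t*) 0 i| ^+ 2.
Proof.
have -> : sqnorm z = (z *m z^t*) 0 0.
  by rewrite mxE; apply: eq_bigr => i _; rewrite !mxE normCK.
case: AP => Pu _; have PP : P ^t* *m P = 1%:M by apply/mulmx1C/unitarymxP.
rewrite -[X in X *m z^t*]mulmx1 -PP -!mulmxA.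
have -> : P *m z ^t* = (z *m P ^t*) ^t*.
  by rewrite trmx_mul map_mxM /= trmxCK.
by rewrite mulmxA mxE; apply: eq_bigr => i _; rewrite !mxE normCK.
Qed.

Lemma diagonalizes_hform_subr (lam : R) z :
  hform A z - toC lam * sqnorm z =
  \sum_i toC (d 0 i - lam) * `|(z *m P ^t*) 0 i| ^+ 2.
Proof.
rewrite diagonalizes_hform diagonalizes_sqnorm mulr_sumr -sumrB.
by apply: eq_bigr => i _; rewrite rmorphB mulrBl.
Qed.

(** By hypothesis the map to the coordinates in [Q] is injective on [N]. *)
Lemma rank_le_card (Q : pred 'I_n) m (N : 'M[C]_(m, n)) :
  (forall z : 'rV_n, (z <= N)%MS -> (forall i, Q i -> (z *m P ^t*) 0 i = 0) ->
    z = 0) -> (\rank N <= #|Q|)%N.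
Proof.
move=> Ninj; pose B := colsub (enum_val : 'I_#|Q| -> 'I_n) (P ^t*).
suff /eqP/mxrank_injP <- : (N :&: kermx B = 0)%MS by exact: rank_leq_col.
apply/eqP/rowV0P => z; rewrite sub_capmx => /andP[zN /sub_kermxP zB].
apply: Ninj => // i Qi; move: zB; rewrite /B mulmx_colsub => /rowP.
by move=> /(_ (enum_rank_in Qi i)); rewrite !mxE enum_rankK_in.
Qed.

(** The span of the eigenvectors indexed by [Q], obtained as the kernel of the other coordinates. *)
Lemma subspace_of_card (Q : pred 'I_n) :
  exists N : 'M[C]_n, (#|Q| <= \rank N)%N /\
    forall z : 'rV_n, (z <= N)%MS -> forall i, ~~ Q i -> (z *m P ^t*) 0 i = 0.
Proof.
pose Qc := [predC Q].
pose B := colsub (enum_val : 'I_#|Qc| -> 'I_n) (P ^t*).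
exists (kermx B); split.
  have := cardC Q; rewrite card_ord mxrank_ker => cQ.
  rewrite -(leq_add2r #|Qc|) cQ -{1}(subnK (rank_leq_row B)) leq_add2l.
  exact: rank_leq_col.
move=> z /sub_kermxP zB i Qi; move: zB; rewrite /B mulmx_colsub => /rowP.
by move=> /(_ (enum_rank_in (Qi : i \in Qc) i)); rewrite !mxE enum_rankK_in.
Qed.

(** A vector with no component along the eigenvalues below [lam] has form at least [lam] times its
    squared norm. *)
Lemma rank_hform_lt (lam : R) m (N : 'M[C]_(m, n)) :
  (forall z : 'rV_n, (z <= N)%MS -> z != 0 -> hform A z < toC lam * sqnorm z) ->
  (\rank N <= #|[pred i | (d 0%R i < lam)%R]|)%N.
Proof.
move=> Nneg; apply: rank_le_card => z zN z0; apply/eqP/negP => /negP zn0.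
have := Nneg z zN zn0; rewrite -subr_lt0 diagonalizes_hform_subr.
rewrite le_gtF // sumr_ge0 // => i _; have [di|di] := ltP (d 0 i) lam.
  by rewrite z0 // normr0 expr0n mulr0.
by rewrite mulr_ge0 ?exprn_ge0 // (_ : 0 = toC 0) ?lecR ?subr_ge0.
Qed.

Lemma rank_hform_gt (lam : R) m (N : 'M[C]_(m, n)) :
  (forall z : 'rV_n, (z <= N)%MS -> z != 0 -> toC lam * sqnorm z < hform A z) ->
  (\rank N <= #|[pred i | (lam < d 0%R i)%R]|)%N.
Proof.
move=> Nneg; apply: rank_le_card => z zN z0; apply/eqP/negP => /negP zn0.
have := Nneg z zN zn0; rewrite -subr_gt0 diagonalizes_hform_subr.
rewrite le_gtF // sumr_le0 // => i _; have [di|di] := ltP lam (d 0 i).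
  by rewrite z0 // normr0 expr0n mulr0.
by rewrite mulr_le0_ge0 ?exprn_ge0 // (_ : 0 = toC 0) ?lecR ?subr_le0.
Qed.

(** If the coordinates at eigenvalues at most [lam] vanish, the remaining terms are nonnegative with
    sum at most 0, so each is 0 and so is the vector. *)
Lemma rank_hform_le (lam : R) m (N : 'M[C]_(m, n)) :
  (forall z : 'rV_n, (z <= N)%MS -> hform A z <= toC lam * sqnorm z) ->
  (\rank N <= #|[pred i | (d 0%R i <= lam)%R]|)%N.
Proof.
move=> Nneg; apply: rank_le_card => z zN z0.
have : sqnorm z = 0.
  have := Nneg z zN; rewrite -subr_le0 diagonalizes_hform_subr => le0.
  have ge0 i : 0 <= toC (d 0 i - lam) * `|(z *m P ^t*) 0 i| ^+ 2.
    have [di|di] := leP (d 0 i) lam; first by rewrite z0 // normr0 expr0n mulr0.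
    by rewrite mulr_ge0 ?exprn_ge0 // (_ : 0 = toC 0) ?lecR ?subr_ge0 ?ltW.
  have /eqP := le_anti (introT andP (conj le0 (sumr_ge0 _ (fun i _ => ge0 i)))).
  rewrite psumr_eq0 // => /allP zi0; rewrite diagonalizes_sqnorm big1 // => i _.
  have [di|di] := leP (d 0 i) lam; first by rewrite z0 // normr0 expr0n.
  have := zi0 i (mem_index_enum i); rewrite mulf_eq0 /= => /orP[|/eqP//].
  by rewrite (_ : 0 = toC 0) // (inj_eq (@complexI R)) subr_eq0 gt_eqF.
by apply: contra_eq => /sqnorm_gt0 /gt_eqF ->.
Qed.

End Diagonalized.
End SpectralCounting.

(** * Position of a simple entry in a sorted list *)

Section SimpleEigenvalue.
Variable R : realDomainType.

Lemma count_le_split (s : seq R) (x : R) :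
  count (<= x) s = (count (< x) s + count_mem x s)%N.
Proof.
by elim: s => //= y s ->; case: ltgtP => _ /=; lia.
Qed.

Lemma sorted_count_simple (s : seq R) k : sorted <=%R s -> (0 < k <= size s)%N ->
  count_mem (nth 0 s k.-1) s = 1%N ->
  count (< nth 0 s k.-1) s = k.-1 /\ count (<= nth 0 s k.-1) s = k.
Proof.
move=> ss /andP[k0 ks] c1; set x := nth 0 s k.-1 in c1 *.
have lt_k : (count (< x) s <= k.-1)%N.
  rewrite leqNgt; apply/negP => h; have := nth_count_lt 0 ss h.
  by rewrite ltxx.
have ge_k : (k <= count (<= x) s)%N.
  rewrite -(prednK k0) ltnNge; apply/negP => h.
  have : (count (<= x) s <= k.-1 < size s)%N by rewrite h prednK.
  by move=> /(nth_count_gt 0 ss); rewrite ltxx.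
move: ge_k; rewrite count_le_split c1 addn1 => ge_k.
have e : count (< x) s = k.-1.
  by apply/eqP; rewrite eqn_leq lt_k -ltnS prednK.
by rewrite e prednK.
Qed.

Lemma sorted_nth_simple (s : seq R) k x : sorted <=%R s -> (0 < k)%N ->
  count (< x) s = k.-1 -> count_mem x s = 1%N -> nth 0 s k.-1 = x.
Proof.
move=> ss k0 cl c1; apply: (nth_count_eq 0 ss).
by rewrite count_le_split cl c1 leqnn addn1 prednK /=.
Qed.

(** Serves twice: for the gap around an eigenvalue, and with [x] zero for a lower bound on the
    nonzero entries of [M]. *)
Lemma exists_separation (s : seq R) (x : R) :
  exists2 delta : R, 0 < delta & forall y, y \in s -> y != x -> delta <= `|y - x|.
Proof.
elim: s => [|y s [delta d0 IH]]; first by exists 1.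
have [->|yx] := eqVneq y x.
  exists delta => // z; rewrite inE => /orP[/eqP->|]; first by rewrite eqxx.
  exact: IH.
exists (Num.min delta `|y - x|); first by rewrite lt_min d0 normr_gt0 subr_eq0.
move=> z; rewrite inE ge_min => /orP[/eqP->|zs zx]; first by rewrite lexx orbT.
by rewrite IH.
Qed.

End SimpleEigenvalue.

(** * Spectral gaps and their stability under perturbation *)

Section Gap.
Local Open Scope sesquilinear_scope.
Variable R : rcfType.
Local Notation C := R[i].
Local Notation toC := (real_complex R).

Lemma diagonalizes_hform_real n P d (A : 'M[R]_n) z :
  diagonalizes P d A -> hform A z \is Num.real.
Proof.
move=> AP; rewrite (diagonalizes_hform AP) rpred_sum // => i _.
rewrite rpredM //; first by apply/complex_realP; exists (d 0 i).
by rewrite ger0_real // exprn_ge0.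
Qed.

(** Each product of two coordinate norms is at most the sum of their squares; in the double sum
    every square then occurs [2n] times. *)
Lemma hform_close n (A B : 'M[R]_n) (eta : R) z :
  (forall i j, `|A i j - B i j| <= eta) ->
  `|hform A z - hform B z| <= toC (eta *+ n *+ 2) * sqnorm z.
Proof.
move=> AB; rewrite !hformE -sumrB.
have term i j : `|toC (A i j) * (z 0 i * (z 0 j)^*) - toC (B i j) * (z 0 i * (z 0 j)^*)|
   <= toC eta * (`|z 0 i| ^+ 2 + `|z 0 j| ^+ 2).
  rewrite -mulrBl -rmorphB normrM ler_pM ?normr_ge0 //.
    by rewrite normc_def /= expr0n addr0 sqrtr_sqr lecR.
  rewrite normrM norm_conjC; move: `|z 0 i| `|z 0 j| (normr_ge0 (z 0 i)) (normr_ge0 (z 0 j)).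
  move=> x y x0 y0; rewrite -subr_ge0.
  have -> : x ^+ 2 + y ^+ 2 - x * y = (x - y) ^+ 2 + x * y by rewrite sqrrB; ring.
  apply: addr_ge0; last exact: mulr_ge0.
  by rewrite real_exprn_even_ge0 // realB ?ger0_real.
have -> : toC (eta *+ n *+ 2) * sqnorm z =
    \sum_i \sum_j toC eta * (`|z 0 i| ^+ 2 + `|z 0 j| ^+ 2).
  under [RHS]eq_bigr do rewrite -mulr_sumr big_split /= sumr_const card_ord.
  rewrite -mulr_sumr big_split /= sumr_const card_ord -sumrMnl -/(sqnorm z).
  by rewrite -mulr2n !rmorphMn /= !mulrnAl !mulrnAr sumrMnl mulrnAr.
apply: (le_trans (ler_norm_sum _ _ _)); apply: ler_sum => i _.
rewrite -sumrB; apply: (le_trans (ler_norm_sum _ _ _)).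
exact: ler_sum.
Qed.

(** The ranks leave at most one dimension, to be filled by [lam] itself; a perturbation only reduces
    the margin [delta]. *)
Definition spectral_gap n (A : 'M[R]_n) (lam : R) (k : nat) (delta : R) : Prop :=
  exists N N' : 'M[C]_n,
  [/\ (k.-1 <= \rank N)%N, (n - k <= \rank N')%N,
     forall z : 'rV_n, (z <= N)%MS -> hform A z <= toC (lam - delta) * sqnorm z
   & forall z : 'rV_n, (z <= N')%MS -> toC (lam + delta) * sqnorm z <= hform A z].

Lemma spectral_gap_close n (A B : 'M[R]_n) lam k delta eta :
  A^T = A -> B^T = B -> (forall i j, `|B i j - A i j| <= eta) ->
  spectral_gap A lam k delta -> spectral_gap B lam k (delta - eta *+ n *+ 2).
Proof.
move=> As Bs AB [N [N' [rN rN' hN hN']]]; exists N, N'.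
(* The diagonalizations show that both forms are real, so that the bound on the norm of their
   difference gives one-sided bounds. *)
have [P [d AP]] := real_symmetric_spectral As.
have [Q [d' BQ]] := real_symmetric_spectral Bs.
have close z : `|hform B z - hform A z| <= toC (eta *+ n *+ 2) * sqnorm z.
  exact: hform_close.
have BAr z : hform B z - hform A z \is Num.real.
  by rewrite realB ?(diagonalizes_hform_real _ AP) ?(diagonalizes_hform_real _ BQ).
set c := eta *+ n *+ 2 in close *; split=> // z zN.
- have hB : hform B z <= hform A z + toC c * sqnorm z.
    by rewrite -lerBlDl (le_trans (real_ler_norm (BAr z))).
  rewrite (_ : lam - (delta - c) = lam - delta + c); last by ring.
  by rewrite rmorphD mulrDl (le_trans hB) // lerD2r hN.
- have hB : hform A z - toC c * sqnorm z <= hform B z.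
    have ABr : hform A z - hform B z \is Num.real by rewrite -opprB rpredN.
    rewrite lerBlDr -lerBlDl (le_trans (real_ler_norm ABr)) //.
    by rewrite distrC.
  rewrite addrA rmorphB mulrBl; apply: le_trans hB.
  by rewrite lerD2r hN'.
Qed.

Lemma card_codom_count n (d : 'rV[R]_n) (p : pred R) :
  #|[pred i | p (d 0 i)]| = count p [seq d 0 i | i : 'I_n].
Proof.
by rewrite -sum1_card -sum1_count big_map big_enum_cond.
Qed.

Lemma spectral_gap_of_simple n (A : 'M[R]_n) (s : seq R) k :
  A^T = A -> sorted <=%R s -> char_poly A = \prod_(x <- s) ('X - x%:P) ->
  (0 < k <= n)%N -> count_mem (nth 0 s k.-1) s = 1%N ->
  exists2 delta, 0 < delta & spectral_gap A (nth 0 s k.-1) k delta.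
Proof.
move=> As ss cp kn c1; have [P [d AP]] := real_symmetric_spectral As.
have sd : perm_eq s [seq d 0 i | i : 'I_n].
  apply: prod_XsubC_eq; rewrite -cp (diagonalizes_char_poly AP).
  by rewrite big_map big_enum.
have szs : size s = n by rewrite (perm_size sd) size_map size_enum_ord.
have [cl cle] := sorted_count_simple ss (eq_ind_r (fun m => 0 < k <= m)%N kn szs) c1.
set lam := nth 0 s k.-1 in cl cle c1 *.
have [delta d0 sep] := exists_separation [seq d 0 i | i : 'I_n] lam.
exists delta => //.
(* [N] and [N'] are spanned by the eigenvectors with eigenvalue below, resp. above, [lam]; all these
   eigenvalues are at distance at least [delta] from [lam]. *)
have [N [rN hN]] := subspace_of_card P [pred i | d 0 i < lam].
have [N' [rN' hN']] := subspace_of_card P [pred i | lam < d 0 i].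
have din i : d 0 i \in [seq d 0 i | i : 'I_n] by apply/mapP; exists i; rewrite ?mem_enum.
exists N, N'; split.
- by rewrite -cl (permP sd) -card_codom_count.
- apply: leq_trans rN'; rewrite card_codom_count -(permP sd) leq_subLR -szs.
  rewrite -cle -(count_predC (<= lam) s) leq_add2l.
  by apply: sub_count => x /=; rewrite ltNge.
- move=> z zN; rewrite rmorphB mulrBl -subr_le0 opprB addrA addrAC (diagonalizes_hform_subr AP).
  rewrite (diagonalizes_sqnorm AP) mulr_sumr -big_split /= sumr_le0 // => i _.
  have [di|di] := boolP (d 0 i < lam); last by rewrite (hN z zN) // normr0 expr0n !mulr0 addr0.
  rewrite -mulrDl -rmorphD mulr_le0_ge0 ?exprn_ge0 // (_ : 0 = toC 0) // lecR.
  have := sep _ (din i) (negbT (lt_eqF di)); rewrite ltr0_norm ?subr_lt0 //; lra.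
- move=> z zN; rewrite rmorphD mulrDl -subr_ge0 opprD addrA (diagonalizes_hform_subr AP).
  rewrite (diagonalizes_sqnorm AP) mulr_sumr -sumrB sumr_ge0 // => i _.
  have [di|di] := boolP (lam < d 0 i); last by rewrite (hN' z zN) // normr0 expr0n !mulr0 subr0.
  rewrite -mulrBl -rmorphB mulr_ge0 ?exprn_ge0 // (_ : 0 = toC 0) // lecR.
  have := sep _ (din i) (negbT (gt_eqF di)); rewrite gtr0_norm ?subr_gt0 //; lra.
Qed.

(** At least [k - 1] eigenvalues lie below [lam], at least [n - k] above and at least one equals it;
    as there are [n] in all, these bounds are equalities. *)
Lemma spectral_gap_simple n (A : 'M[R]_n) lam k delta :
  A^T = A -> (0 < k <= n)%N -> 0 < delta -> spectral_gap A lam k delta ->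
  eigenvalue A lam ->
  exists s, [/\ sorted <=%R s, char_poly A = \prod_(x <- s) ('X - x%:P),
    nth 0 s k.-1 = lam & count_mem lam s = 1%N].
Proof.
move=> As /andP[k0 kn] d0 [N [N' [rN rN' hN hN']]] ev.
have [P [d AP]] := real_symmetric_spectral As.
pose t := [seq d 0 i | i : 'I_n].
have cp : char_poly A = \prod_(x <- t) ('X - x%:P).
  by rewrite (diagonalizes_char_poly AP) big_map big_enum.
have st : size t = n by rewrite size_map size_enum_ord.
have lt_t : (k.-1 <= count (< lam) t)%N.
  rewrite -card_codom_count (leq_trans rN) // (rank_hform_lt AP) // => z zN z0.
  apply: (le_lt_trans (hN z zN)); rewrite ltr_pM2r ?sqnorm_gt0 // ltcR; lra.
have gt_t : (n - k <= count (> lam) t)%N.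
  rewrite -card_codom_count (leq_trans rN') // (rank_hform_gt AP) // => z zN z0.
  apply: (lt_le_trans _ (hN' z zN)); rewrite ltr_pM2r ?sqnorm_gt0 // ltcR; lra.
have eq_t : (0 < count_mem lam t)%N.
  by rewrite -has_count has_pred1; move: ev; rewrite eigenvalue_root_char cp root_prod_XsubC.
have : (count (< lam) t + count_mem lam t + count (> lam) t = n)%N.
  rewrite -count_le_split -st -(count_predC (<= lam) t); congr addn.
  by apply: eq_count => x /=; rewrite ltNge.
move=> sum_n; have [ct1 ct2] : count (< lam) t = k.-1 /\ count_mem lam t = 1%N by lia.
exists (sort <=%R t); split.
- exact: sort_sorted (@le_total _ _) _.
- by rewrite cp; apply: perm_big; rewrite perm_sym perm_sort.
- apply: sorted_nth_simple => //; first exact: sort_sorted (@le_total _ _) _.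
    by rewrite -ct1; apply/permP; rewrite perm_sort.
  by rewrite -ct2; apply/permP; rewrite perm_sort.
- by rewrite -ct2; apply/permP; rewrite perm_sort.
Qed.

End Gap.

(** * Courant's nodal domain theorem *)

Section Courant.
Variables (R : realType) (V : finType) (e : rel V).
Hypothesis e_sym : symmetric e.
Local Notation C := R[i].
Local Notation toC := (real_complex R).
Implicit Types (M : V -> V -> R) (f : V -> R).

(** At a zero of [f] the second branch returns the vertex itself, which is isolated there;
    [card_domain_root] therefore excludes zeros. *)
Definition domain_root f v : V :=
  if 0 < f v then fingraph.root (induced e [set v | 0 < f v]) v
  else fingraph.root (induced e [set v | f v < 0]) v.

Lemma induced_connect_sym (D : {set V}) : connect_sym (induced e D).
Proof.
by apply: sym_connect_sym => u v; rewrite /induced /= e_sym andbCA.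
Qed.

Lemma domain_root_edge f u v : e u v -> 0 < f u * f v ->
  domain_root f u = domain_root f v.
Proof.
move=> euv fuv; rewrite /domain_root.
have [fu|fu|fu] := ltgtP (f u) 0; last by move: fuv; rewrite fu mul0r ltxx.
- move: fuv; rewrite nmulr_rgt0 // => fv; rewrite lt_gtF //.
  apply/(fingraph.rootP (induced_connect_sym _))/connect1.
  by rewrite /induced /= !inE fu fv.
- move: fuv; rewrite pmulr_rgt0 // => fv; rewrite fv.
  apply/(fingraph.rootP (induced_connect_sym _))/connect1.
  by rewrite /induced /= !inE fu fv.
Qed.

Lemma card_domain_root f :
  #|[set v | (f v != 0) && (domain_root f v == v)]| = SND e f.
Proof.
rewrite -(cardsID [set v | 0 < f v]) /SND /num_components /n_comp_mem.
congr addn; apply: eq_card => v; rewrite !inE /roots /domain_root /=.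
- by have [fv|fv|fv] := ltgtP (f v) 0; rewrite ?andbT ?andbF.
- by have [fv|fv|fv] := ltgtP (f v) 0; rewrite ?andbT ?andbF.
Qed.

Lemma hform_matrix_of M (z : 'rV[C]_#|V|) (x : V -> C) :
  (forall i, z 0 i = x (enum_val i)) ->
  hform (matrix_of M) z = \sum_u \sum_v toC (M u v) * (x u * (x v)^*).
Proof.
move=> zx; rewrite hformE [RHS](reindex _ (onW_bij _ (@enum_val_bij V))) /=.
apply: eq_bigr => i _; rewrite [RHS](reindex _ (onW_bij _ (@enum_val_bij V))) /=.
by apply: eq_bigr => j _; rewrite mxE !zx.
Qed.

Lemma sqnorm_enum (z : 'rV[C]_#|V|) (x : V -> C) :
  (forall i, z 0 i = x (enum_val i)) -> sqnorm z = \sum_u `|x u| ^+ 2.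
Proof.
move=> zx; rewrite [RHS](reindex _ (onW_bij _ (@enum_val_bij V))) /=.
by apply: eq_bigr => i _; rewrite zx.
Qed.

(* With [c] constant on the nodal domains, the form of [M - lam] at [c * f] is
   [- 1/2 \sum M u v * f u * f v * |c u - c v|^2]. *)
Lemma hform_domain_le0 M lam f (c : V -> C) :
  generalized_laplacian e M -> (forall u, \sum_v M u v * f v = lam * f u) ->
  (forall u v, e u v -> 0 < f u * f v -> c u = c v) ->
  \sum_u \sum_v toC (M u v) * (toC (f u) * c u * (toC (f v) * c v)^*)
    <= toC lam * \sum_u `|toC (f u) * c u| ^+ 2.
Proof.
move=> [Ms M0 Mneg] eig cE.
pose q u v := toC (M u v * f u * f v).
have qs u v : q u v = q v u by rewrite /q Ms mulrAC.
have -> : \sum_u \sum_v toC (M u v) * (toC (f u) * c u * (toC (f v) * c v)^*) =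
   \sum_u \sum_v q u v * (c u * (c v)^*).
  apply: eq_bigr => u _; apply: eq_bigr => v _.
  rewrite rmorphM /= conj_Creal; last by apply/complex_realP; exists (f v).
  by rewrite /q !rmorphM /=; ring.
(* The eigenvalue equation expands [lam * f u] into a row sum, so that both sides carry the same
   weights [q]. *)
have -> : toC lam * \sum_u `|toC (f u) * c u| ^+ 2 =
   \sum_u \sum_v q u v * `|c u| ^+ 2.
  rewrite mulr_sumr; apply: eq_bigr => u _; rewrite -mulr_suml.
  rewrite normrM exprMn mulrA; congr (_ * _).
  rewrite -rmorph_sum /= (_ : `|toC (f u)| ^+ 2 = toC (f u ^+ 2)); last first.
    by rewrite real_normK ?rmorphXn //; apply/complex_realP; exists (f u).
  rewrite -rmorphM; congr (toC _); rewrite expr2 mulrA -eig mulr_suml.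
  by apply: eq_bigr => v _; rewrite mulrAC.
pose T u v := q u v * (c u * (c v)^* - `|c u| ^+ 2).
have SE : \sum_u \sum_v q u v * (c u * (c v)^*) - \sum_u \sum_v q u v * `|c u| ^+ 2
    = \sum_u \sum_v T u v.
  rewrite -sumrB; apply: eq_bigr => u _; rewrite -sumrB; apply: eq_bigr => v _.
  by rewrite -mulrBr.
(* Doubling the sum and swapping [u] and [v] in one copy pairs [T u v] with [T v u]. *)
rewrite -subr_le0 SE -(pmulrn_lle0 _ (ltn0Sn 1)) mulr2n {2}exchange_big /=.
rewrite -big_split /= sumr_le0 // => u _; rewrite -big_split /= sumr_le0 // => v _.
have -> : T u v + T v u = - (q u v * `|c u - c v| ^+ 2).
  by rewrite /T -(qs u v) !normCK rmorphB /=; ring.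
rewrite oppr_le0; have [cuv|cuv] := eqVneq (c u) (c v).
  by rewrite cuv subrr normr0 expr0n mulr0.
rewrite mulr_ge0 ?exprn_ge0 // (_ : 0 = toC 0) // lecR.
(* Distinct values of [c] exclude the diagonal, whose entries have no prescribed sign; on an edge
   they force [f u * f v <= 0]. *)
have uv : u != v by apply: contra_neq cuv => ->.
have [euv|euv] := boolP (e u v); last by rewrite M0 // !mul0r.
rewrite -mulrA nmulr_rge0 ?Mneg // leNgt; apply: contra_neqN cuv; exact: cE.
Qed.

Lemma courant_nodal_domains M lam f (d : 'rV[R]_#|V|) P :
  generalized_laplacian e M -> (forall u, \sum_v M u v * f v = lam * f u) ->
  diagonalizes P d (matrix_of M) ->
  (SND e f <= #|[pred i | (d 0%R i <= lam)%R]|)%N.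
Proof.
move=> Ml eig MP; rewrite -card_domain_root.
set J := [set v | _].
(* Row [a] is the restriction of [f] to the nodal domain with root [enum_val a]; evaluating a
   combination of rows at that root isolates the coefficient of row [a]. *)
pose U : 'M[C]_(#|J|, #|V|) := \matrix_(a, i)
  (toC (f (enum_val i)) * (domain_root f (enum_val i) == enum_val a)%:R).
have Uy (y : 'rV_#|J|) i : (y *m U) 0 i = toC (f (enum_val i)) *
    \sum_a y 0 a * (domain_root f (enum_val i) == enum_val a)%:R.
  rewrite mxE mulr_sumr; apply: eq_bigr => a _; rewrite mxE; ring.
have Ufree : row_free U.
  apply/inj_row_free => y yU0; apply/rowP => a; rewrite mxE.
  have := Uy y (enum_rank (enum_val a)); rewrite yU0 mxE enum_rankK.
  have := enum_valP a; rewrite inE => /andP[fa /eqP ra].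
  rewrite ra (bigD1 a) //= eqxx mulr1 big1 ?addr0 => [/esym/eqP|b ba].
    by rewrite mulf_eq0 (inj_eq (@complexI R) _ 0) (negPf fa) => /eqP.
  by rewrite (inj_eq enum_val_inj) eq_sym (negPf ba) mulr0.
rewrite -(eqP Ufree) (rank_hform_le MP) // => z /submxP[y ->].
pose c v := \sum_a y 0 a * (domain_root f v == enum_val a)%:R.
rewrite (@hform_matrix_of _ _ (fun v => toC (f v) * c v)); last exact: Uy.
rewrite (@sqnorm_enum _ (fun v => toC (f v) * c v)); last exact: Uy.
apply: hform_domain_le0 => // u v euv fuv.
by rewrite /c (domain_root_edge euv fuv).
Qed.

End Courant.

(** * Perturbing away the zeros of an eigenvector *)

(** Among [size p] distinct candidates [eta / i.+1], one is not a root. *)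
Lemma exists_small_nonroot (R : numFieldType) (p : {poly R}) (eta : R) :
  p != 0 -> 0 < eta -> exists t, [/\ 0 < t, t <= eta & ~~ root p t].
Proof.
move=> p0 eta0; pose ts := [seq eta / (i.+1%:R) | i <- iota 0 (size p)].
have ts_uniq : uniq ts.
  rewrite map_inj_uniq ?iota_uniq // => i j /(mulfI (lt0r_neq0 eta0)) /invr_inj.
  by move=> /(@mulrIn _ 1 (oner_neq0 _)) [].
have := contraNN (fun x => max_poly_roots p0 x ts_uniq).
rewrite size_map size_iota ltnn => /(_ isT) /allPn[t /mapP[i _ ->] nr].
exists (eta / i.+1%:R); split=> //; first by rewrite divr_gt0 ?ltr0n.
by rewrite ler_pdivrMr ?ltr0n // (ler_peMr (ltW eta0)) ?ler1n.
Qed.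

Section Perturbation.
Variables (R : realType) (V : finType) (e : rel V).
Hypothesis e_sym : symmetric e.
Implicit Types (M : V -> V -> R) (f g : V -> R).

Lemma sum_enum_val (F : V -> R) : \sum_(i < #|V|) F (enum_val i) = \sum_v F v.
Proof. by rewrite [RHS](reindex _ (onW_bij _ (@enum_val_bij V))). Qed.

(** Let [K] be [lam - M] cut down to [W]. A small [t] that is not an eigenvalue makes [K - t]
    invertible; off [W], where [K] is zero, [t > 0] forces [x] to vanish. *)
Lemma exists_dirichlet_solvable M (W : pred V) (lam eta : R) : 0 < eta ->
  exists t, [/\ 0 < t, t <= eta & forall r : V -> R, exists x : V -> R,
    (forall u, ~~ W u -> x u = 0) /\
    (forall u, W u -> \sum_v M u v * x v + (t - lam) * x u = r u)].
Proof.
move=> eta0.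
pose K u v := if W u && W v then lam * (u == v)%:R - M v u else 0.
have [t [t0 te nr]] :=
  exists_small_nonroot (monic_neq0 (char_poly_monic (matrix_of K))) eta0.
exists t; split=> // r.
have Ku : matrix_of K - t%:M \in unitmx.
  rewrite -row_free_unit -kermx_eq0; move: nr.
  by rewrite -eigenvalue_root_char /eigenvalue negbK.
pose rr : 'rV[R]_#|V| := \row_i (if W (enum_val i) then - r (enum_val i) else 0).
have [y yE] : exists y, y *m (matrix_of K - t%:M) = rr.
  by exists (rr *m invmx (matrix_of K - t%:M)); rewrite mulmxKV.
pose x v := y 0 (enum_rank v).
have xE v : \sum_u x u * K u v - t * x v = if W v then - r v else 0.
  have /rowP/(_ (enum_rank v)) := yE; rewrite mulmxBr mul_mx_scalar !mxE enum_rankK => <-; congr (_ - _).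
rewrite -sum_enum_val; apply: eq_bigr => i _.
  by rewrite /x !mxE enum_valK enum_rankK.
have x0 u : ~~ W u -> x u = 0.
  move=> Wu; have := xE u; rewrite (negPf Wu) big1 => [/eqP|v _].
    by rewrite sub0r oppr_eq0 mulf_eq0 (gt_eqF t0) => /eqP.
  by rewrite /K (negPf Wu) andbF mulr0.
exists x; split=> // u Wu; have := xE u; rewrite Wu => /(canRL (subrK _)) xEu.
have : \sum_v x v * K v u = lam * x u - \sum_v M u v * x v.
  rewrite (_ : lam * x u = \sum_v lam * (v == u)%:R * x v); last first.
    rewrite (bigD1 u) //= eqxx mulr1 big1 ?addr0 // => v /negPf ->.
    by rewrite mulr0 mul0r.
  rewrite -sumrB; apply: eq_bigr => v _; rewrite /K Wu andbT.
  by have [Wv|Wv] := boolP (W v); [ring | rewrite x0 // !(mul0r, mulr0) subr0].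
rewrite xEu => h; rewrite mulrBl; lra.
Qed.

Definition boundary f u : bool := (f u == 0) && [exists v, e u v && (f v != 0)].

(** Otherwise the zero set would be closed under adjacency, hence empty or everything. *)
Lemma exists_boundary f : connected_graph e -> (exists v, f v != 0) ->
  (exists v, f v = 0) -> exists b, boundary f b.
Proof.
move=> econ [v fv] [w fw].
have [/existsP//|/existsPn nob] := boolP [exists b, boundary f b].
have cl : closed e [pred u | f u == 0].
  apply: (intro_closed (sym_connect_sym e_sym)) => u u' euu' /= fu.
  rewrite inE; apply: contraR (nob u) => fu'; rewrite /boundary.
  by rewrite -[f u == 0]/(u \in [pred u | f u == 0]) fu; apply/existsP; exists u'; rewrite euu'.
have := closed_connect cl (econ v w).
by rewrite !inE fw eqxx (negPf fv).
Qed.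

Lemma perturb_boundary M f lam b sigma eta :
  generalized_laplacian e M -> (forall u, \sum_v M u v * f v = lam * f u) ->
  boundary f b -> 0 < eta ->
  exists M' f' eps,
  [/\ generalized_laplacian e M', forall u v, `|M' u v - M u v| <= eta,
      forall u, \sum_v M' u v * f' v = lam * f' u,
      forall v, f v != 0 -> f' v = f v
    & 0 < eps /\ f' b = eps * sigma].
Proof.
move=> Ml eig bb eta_gt0; have [Ms M0 Mneg] := Ml.
(* Nonzero entries of [M] have absolute value at least [m], so changes of at most [m / 2] keep the
   edge weights negative. *)
have [m m0 Mm] := exists_separation [seq M p.1 p.2 | p : V * V] 0.
pose eta0 := Num.min eta (m / 2).
have eta0_gt0 : 0 < eta0 by rewrite lt_min eta_gt0 divr_gt0 // ltr0n.
pose W u := (f u == 0) && ~~ boundary f u.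
have half_gt0 : 0 < eta0 / 2 by rewrite divr_gt0 // ltr0n.
have [t [t0 te solv]] := exists_dirichlet_solvable M W lam half_gt0.
have [x [x0 xE]] := solv (fun u => - (M u b * sigma)).
have fb : f b = 0 by case/andP: bb => /eqP.
pose g u := x u + sigma * (u == b)%:R.
have gb : g b = sigma by rewrite /g x0 ?add0r ?eqxx ?mulr1 // /W bb andbF.
have g0 u : f u != 0 -> g u = 0.
  move=> fu; have ub : (u == b) = false.
    by apply: (contraNF _ fu) => /eqP ->; rewrite fb.
  by rewrite /g ub mulr0 addr0 x0 // /W (negPf fu).
(* [eps * rho] is the residual of [f + eps * g] for [M + t * 1_W]. *)
pose rho u := \sum_v M u v * g v + (t * (W u)%:R - lam) * g u.
have rhoW u : W u -> rho u = 0.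
  move=> Wu; have ub : u != b by apply: contraTneq Wu => ->; rewrite /W bb andbF.
  have gu : g u = x u by rewrite /g (negPf ub) mulr0 addr0.
  have -> : rho u = \sum_v M u v * x v + M u b * sigma + (t - lam) * x u.
    rewrite /rho Wu mulr1 gu; congr (_ + _).
    rewrite /g; under eq_bigr do rewrite mulrDr; rewrite big_split /=; congr (_ + _).
    rewrite (bigD1 b) //= eqxx mulr1 big1 ?addr0 // => v /negPf ->.
    by rewrite !mulr0.
  by rewrite addrAC xE // addNr.
(* A chosen neighbour in the support; the default is never reached at a boundary vertex. *)
pose pi u := odflt u [pick v | e u v && (f v != 0)].
have piP u : boundary f u -> e u (pi u) /\ f (pi u) != 0.
  rewrite /pi => /andP[_ /existsP[v euv]]; case: pickP => [w /andP[]//|/(_ v)].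
  by rewrite euv.
(* [eps * (a + a^T)] cancels the residual on the boundary, by way of one edge per
   boundary vertex, and [eps * h] then cancels it on the support; both [a] and [h]
   vanish where the division is by [f u = 0]. *)
pose a u v := if boundary f u && (v == pi u) then - rho u / f v else 0.
have a_edge u v : a u v != 0 -> e u v.
  rewrite /a; case: ifP => [/andP[/piP[eu _] /eqP->//]|_]; by rewrite eqxx.
(* [K] bounds the corrections without reference to [eps]: [h] does depend on [eps], but [eps <= 1]
   absorbs this. *)
pose K := \sum_u \sum_v (`|a u v| + `|a v u|) +
          \sum_u ((`|rho u| + \sum_v `|a v u| * `|g v|) / `|f u|).
have K0 : 0 <= K.
  rewrite addr_ge0 // sumr_ge0 // => u _; first by rewrite sumr_ge0 // => v _; rewrite addr_ge0.
  by rewrite divr_ge0 // addr_ge0 // sumr_ge0 // => v _; rewrite mulr_ge0.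
(* Half of [eta0] is reserved for the diagonal shift [t], the other half for [eps * K]. *)
pose eps := Num.min 1 (eta0 / 2 / (K + 1)).
have K1 : 0 < K + 1 by rewrite ltr_wpDl.
have eps0 : 0 < eps by rewrite lt_min ltr01 divr_gt0.
have eps1 : eps <= 1 by rewrite ge_min lexx.
have epsK : eps * K <= eta0 / 2.
  have : eps <= eta0 / 2 / (K + 1) by rewrite ge_min lexx orbT.
  rewrite ler_pdivlMr // mulrDr mulr1; lra.
pose f' u := f u + eps * g u.
pose h u := - (rho u + \sum_v a v u * (eps * g v)) / f u.
pose M' u v := M u v + eps * (a u v + a v u) +
  (u == v)%:R * (t * (W u)%:R + eps * h u).
have hb u : `|h u| <= (`|rho u| + \sum_v `|a v u| * `|g v|) / `|f u|.
  rewrite /h normrM normrN normfV ler_wpM2r ?invr_ge0 //.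
  rewrite (le_trans (ler_normD _ _)) // lerD2l (le_trans (ler_norm_sum _ _ _)) //.
  apply: ler_sum => v _; rewrite normrM ler_wpM2l // normrM (gtr0_norm eps0).
  by rewrite ler_piMl.
have close u v : `|M' u v - M u v| <= eta0.
  have -> : M' u v - M u v =
    eps * ((a u v + a v u) + (u == v)%:R * h u) + (u == v)%:R * (t * (W u)%:R).
    by rewrite /M'; ring.
  rewrite (splitr eta0) (le_trans (ler_normD _ _)) // lerD //; last first.
    rewrite normrM normrM !normr_nat (gtr0_norm t0).
    case: (u == v) (W u) => - [] /=; lra.
  apply: le_trans epsK; rewrite normrM gtr0_norm // ler_pM2l //.
  rewrite (le_trans (ler_normD _ _)) // lerD //.
    rewrite (bigD1 u) //= (bigD1 v) //= (le_trans (ler_normD _ _)) //.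
    rewrite -addrA lerDl addr_ge0 ?sumr_ge0 // => w _; first by rewrite addr_ge0.
    by rewrite sumr_ge0 // => w' _; rewrite addr_ge0.
  rewrite normrM normr_nat (bigD1 u) //= (le_trans _ (ler_wpDr _ (hb u))) //.
    by case: (u == v); rewrite ?mul1r ?mul0r.
  rewrite sumr_ge0 // => w _.
  by rewrite divr_ge0 // addr_ge0 // sumr_ge0 // => w' _; rewrite mulr_ge0.
exists M', f', eps; split.
- split=> u v.
  + rewrite /M' Ms [a u v + _]addrC [v == u]eq_sym; congr (_ + _).
    by have [->|_] := eqVneq u v; rewrite ?mul0r.
  + move=> uv euv; rewrite /M' (negPf uv) mul0r addr0 M0 // add0r.
    have [/eqP->|/a_edge] := boolP (a u v == 0); last by rewrite (negPf euv).
    have [/eqP->|/a_edge] := boolP (a v u == 0); last by rewrite e_sym (negPf euv).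
    by rewrite addr0 mulr0.
  + move=> euv; have Mlt := Mneg u v euv.
    have : m <= `|M u v - 0|.
      apply: Mm; last by rewrite lt_eqF.
      by apply/mapP; exists (u, v); rewrite ?mem_enum.
    rewrite subr0 ltr0_norm // => mM.
    have : eta0 <= m / 2 by rewrite ge_min lexx orbT.
    have := le_trans (ler_norm _) (close u v); lra.
- by move=> u v; apply: (le_trans (close u v)); rewrite ge_min lexx.
- move=> u.
  have -> : \sum_v M' u v * f' v = lam * f u + eps * (\sum_v M u v * g v) +
     eps * (\sum_v a u v * f' v + \sum_v a v u * f' v) +
     (t * (W u)%:R + eps * h u) * f' u.
    rewrite -eig mulr_sumr -!big_split mulr_sumr -big_split /=.
    rewrite (_ : (t * (W u)%:R + eps * h u) * f' u =
      \sum_v (u == v)%:R * (t * (W u)%:R + eps * h u) * f' v).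
      rewrite -big_split; apply: eq_bigr => v _ /=; rewrite /M' /f'; ring.
    rewrite (bigD1 u) //= eqxx mul1r big1 ?addr0 // => v; rewrite eq_sym => /negPf ->.
    by rewrite !mul0r.
  (* [a v u] is nonzero only when [v] is a zero of [f]. *)
  have -> : \sum_v a v u * f' v = \sum_v a v u * (eps * g v).
    apply: eq_bigr => v _; rewrite /f' /a; case: ifP => [|_]; last by rewrite !mul0r.
    by case/andP => /andP[/eqP-> _] _; rewrite add0r.
  have gE : \sum_v M u v * g v = rho u - (t * (W u)%:R - lam) * g u by rewrite /rho addrK.
  rewrite gE; have [fu|fu] := eqVneq (f u) 0.
    have -> : \sum_v a v u * (eps * g v) = 0.
      by rewrite big1 // => v _; rewrite /a fu invr0 mulr0 if_same mul0r.
    have -> : h u = 0 by rewrite /h fu invr0 mulr0.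
    (* At a boundary vertex only [pi u] contributes, and there [f'] equals [f]; any other zero lies
       in [W], where [rho] vanishes. *)
    have -> : \sum_v a u v * f' v = - rho u.
      have [bu|bu] := boolP (boundary f u); last first.
        rewrite rhoW ?oppr0 ?/W ?fu ?eqxx // big1 // => v _.
        by rewrite /a (negPf bu) mul0r.
      have [_ fpi] := piP u bu.
      rewrite (bigD1 (pi u)) //= big1 => [|v /negPf pv].
        by rewrite /a bu eqxx /f' g0 // mulr0 !addr0 divfK.
      by rewrite /a pv andbF mul0r.
    rewrite /f' fu; ring.
  have Wu : W u = false by rewrite /W (negPf fu).
  have -> : \sum_v a u v * f' v = 0.
    by rewrite big1 // => v _; rewrite /a /boundary (negPf fu) mul0r.
  rewrite /f' g0 // Wu /h mulr0n; field.
  by [].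
- by move=> v fv; rewrite /f' g0 // mulr0 addr0.
- by rewrite /f' fb add0r gb.
Qed.

End Perturbation.

(** * Iterating the perturbation until no zero remains *)

Section Extension.
Variables (R : realType) (V : finType) (e : rel V).
Hypothesis e_sym : symmetric e.
Hypothesis e_conn : connected_graph e.
Implicit Types (M : V -> V -> R) (f g : V -> R).

Lemma matrix_of_sym M : (forall u v, M u v = M v u) -> (matrix_of M)^T = matrix_of M.
Proof. by move=> Ms; apply/matrixP => i j; rewrite !mxE. Qed.

(** The invariant of the iteration: [lam] and [k] stay fixed while [delta] may shrink. *)
Definition gapped_eigenpair M f lam k delta : Prop :=
  [/\ generalized_laplacian e M, forall u, \sum_v M u v * f v = lam * f u,
      0 < delta & spectral_gap (matrix_of M) lam k delta].

Lemma gapped_perturb_boundary M f lam k delta b sigma :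
  gapped_eigenpair M f lam k delta -> boundary e f b ->
  exists M' f' delta' eps,
  [/\ gapped_eigenpair M' f' lam k delta', forall v, f v != 0 -> f' v = f v,
      0 < eps & f' b = eps * sigma].
Proof.
(* With [n + 1] in place of [n], the loss [2n * eta] stays strictly below [delta]. *)
move=> [Ml eig d0 gap] bb; pose eta := delta / (#|V|.+1 * 2)%:R.
have eta0 : 0 < eta by rewrite divr_gt0 // ltr0n muln_gt0.
have [M' [f' [eps [Ml' close eig' ext [eps0 fb]]]]] :=
  perturb_boundary e_sym sigma Ml eig bb eta0.
exists M', f', (delta - eta *+ #|V| *+ 2), eps; split=> //; split=> //.
- have : eta *+ #|V|.+1 *+ 2 = delta.
    by rewrite -mulrnA -mulr_natr divfK // pnatr_eq0 muln_eq0.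
  rewrite [eta *+ #|V|.+1]mulrSr mulrnDl; move: (eta *+ #|V| *+ 2) => c.
  by rewrite mulr2n; move: eta0; lra.
- apply: (spectral_gap_close _ _ _ gap).
  + by apply: matrix_of_sym; case: Ml.
  + by apply: matrix_of_sym; case: Ml'.
  + by move=> i j; rewrite !mxE.
Qed.

(** Induction on a bound for the number of zeros: each perturbation removes the zero [b] and, being
    the identity on the support, creates none. *)
Lemma gapped_extend_nowhere_zero M f lam k delta :
  gapped_eigenpair M f lam k delta -> (exists v, f v != 0) ->
  exists M' f' delta',
  [/\ gapped_eigenpair M' f' lam k delta', forall v, f v != 0 -> f' v = f v
    & nowhere_zero f'].
Proof.
move: {2}#|Urschel f| (leqnn #|Urschel f|) => m.
elim: m M f delta => [|m IHm] M f delta fm gp [v fv].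
  exists M, f, delta; split=> // u; apply/negP => fu.
  by move: fm; rewrite leqn0 cards_eq0 => /eqP/setP/(_ u); rewrite !inE fu.
have [/existsP[w /eqP fw]|/existsPn nz] := boolP [exists w, f w == 0]; last first.
  by exists M, f, delta.
have [b bb] : exists b, boundary e f b.
  by apply: exists_boundary => //; [exists v | exists w].
have [M1 [f1 [d1 [eps [gp1 ext1 eps0 f1b]]]]] := gapped_perturb_boundary 1 gp bb.
have f1b0 : f1 b != 0 by rewrite f1b mulr1 gt_eqF.
have f10 : forall u, f u != 0 -> f1 u != 0 by move=> u fu; rewrite ext1.
have [||M' [f' [d' [gp' ext' nz']]]] := IHm M1 f1 d1 _ gp1.
- rewrite -ltnS (leq_trans _ fm) // proper_card //; apply/properP; split.
    by apply/subsetP => u; rewrite !inE; apply: contraLR; exact: f10.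
  by exists b; rewrite !inE ?(negPf f1b0) //; case/andP: bb.
- by exists v; apply: f10.
exists M', f', d'; split=> // u fu; rewrite ext' ?ext1 //; exact: f10.
Qed.

(** The first perturbation settles the sign at [b]; the later ones preserve nonzero values. *)
Lemma gapped_signing M f lam k delta b sigma :
  gapped_eigenpair M f lam k delta -> (exists v, f v != 0) ->
  boundary e f b -> sigma != 0 ->
  exists M' f' delta',
  [/\ gapped_eigenpair M' f' lam k delta', is_signing f f'
    & Num.sg (f' b) = Num.sg sigma].
Proof.
move=> gp [v fv] bb sigma0.
have [M1 [f1 [d1 [eps [gp1 ext1 eps0 f1b]]]]] := gapped_perturb_boundary sigma gp bb.
have [|M' [f' [d' [gp' ext' nz']]]] := gapped_extend_nowhere_zero gp1.
  by exists v; rewrite ext1.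
have ext u : f u != 0 -> f' u = f u by move=> fu; rewrite ext' ext1.
exists M', f', d'; split=> //.
  by split=> // u fu; rewrite ext ?(gt_eqF fu) ?(lt_eqF fu).
rewrite ext' ?f1b ?mulf_neq0 ?(gt_eqF eps0) //.
by rewrite sgrM gtr0_sg // mul1r.
Qed.

Lemma gapped_kth_simple M f lam k delta : (0 < k <= #|V|)%N ->
  gapped_eigenpair M f lam k delta -> (exists v, f v != 0) ->
  (exists s, [/\ is_spectrum M s, kth_eigenvalue s k = lam,
     kth_eigenvalue_simple s k & eigenvector M lam f]) /\ (SND e f <= k)%N.
Proof.
move=> kV [Ml eig d0 gap] [v fv].
have Ms : (matrix_of M)^T = matrix_of M by apply: matrix_of_sym; case: Ml.
have ev : eigenvalue (matrix_of M) lam.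
  apply/eigenvalueP; exists (\row_i f (enum_val i)).
    apply/rowP => i; rewrite !mxE -eig -[RHS]sum_enum_val; apply: eq_bigr => j _.
    by rewrite !mxE mulrC; case: Ml => ->.
  by apply/rV0Pn; exists (enum_rank v); rewrite mxE enum_rankK.
have [s [ss sp nths c1]] := spectral_gap_simple Ms kV d0 gap ev.
have [P [d MP]] := real_symmetric_spectral Ms.
split; first by exists s; split=> //; [rewrite /kth_eigenvalue_simple /kth_eigenvalue nths
  | split => //; exists v].
have sd : perm_eq s [seq d 0 i | i : 'I_#|V|].
  apply: prod_XsubC_eq; rewrite -sp (diagonalizes_char_poly MP).
  by rewrite big_map big_enum.
have szs : size s = #|V| by rewrite (perm_size sd) size_map size_enum_ord.
have ks : (0 < k <= size s)%N by rewrite szs.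
(* Simplicity makes exactly [k] eigenvalues at most [lam], which is the count in Courant's bound. *)
have [_ cle] := sorted_count_simple ss ks (eq_ind_r (fun x => count_mem x s = 1%N) c1 nths).
rewrite -[X in (_ <= X)%N]cle nths (permP sd) -card_codom_count.
exact: (courant_nodal_domains e_sym Ml eig MP).
Qed.

(** Inequivalent signings come from distinct sets [S1] and [S2], so at least two entries of the list
    are at most [k], hence also the entry at index 1 after sorting. *)
Lemma UN2_le f g1 g2 k : is_signing f g1 -> is_signing f g2 ->
  ~ equiv_signing g1 g2 -> (SND e g1 <= k)%N -> (SND e g2 <= k)%N ->
  (UN e f 2 <= k)%N.
Proof.
move=> s1 s2 ne12 k1 k2.
have [S1 S1U e1] := canonical_signing_ex s1.
have [S2 S2U e2] := canonical_signing_ex s2.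
have S12 : S1 != S2.
  by apply/eqP => S12; apply: ne12 => v; rewrite e1 S12 -e2.
rewrite /UN /=; set t := [seq _ | _ <- _].
apply: (@nth_count_le _ nat) => //; first exact: sort_sorted leq_total _.
rewrite (permP (permEl (perm_sort leq t))) /t count_map -size_filter.
apply: (@uniq_leq_size _ [:: S1; S2]); first by rewrite /= inE S12.
move=> S; rewrite !inE mem_filter mem_enum /= => /orP[]/eqP ->.
- by rewrite S1U andbT -(SND_equiv e e1).
- by rewrite S2U andbT -(SND_equiv e e2).
Qed.

End Extension.

Theorem theorem2p10 (R : realType) (V : finType) (e : rel V)
  (e_sym : symmetric e) (e_irr : irreflexive e) (e_conn : connected_graph e)
  (M : V -> V -> R) (M_lap : generalized_laplacian e M)
  (s : seq R) (s_spec : is_spectrum M s)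
  (k : nat) (k_range : (1 <= k <= #|V|)%N)
  (k_simple : kth_eigenvalue_simple s k)
  (f : V -> R) (f_eig : eigenvector M (kth_eigenvalue s k) f)
  (f_zero : Urschel f != set0) :
  (exists (M' M'' : V -> V -> R) (s' s'' : seq R) (f' f'' : V -> R),
    [/\ generalized_laplacian e M', is_spectrum M' s',
        kth_eigenvalue_simple s' k
      & eigenvector M' (kth_eigenvalue s' k) f'] /\
    [/\ generalized_laplacian e M'', is_spectrum M'' s'',
        kth_eigenvalue_simple s'' k
      & eigenvector M'' (kth_eigenvalue s'' k) f''] /\
    [/\ is_signing f f', is_signing f f'' & ~ equiv_signing f' f''] /\
    [/\ nowhere_zero f', nowhere_zero f'',
        (SND e f' <= k)%N & (SND e f'' <= k)%N]) /\
  (UN e f 2 <= k)%N.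
Proof.
have [[v fv] eig] := f_eig; have [ss sp] := s_spec.
have [w fw] : exists w, f w = 0.
  by case/set0Pn: f_zero => w; rewrite inE => /eqP; exists w.
have Ms : (matrix_of M)^T = matrix_of M by apply: matrix_of_sym; case: M_lap.
have [delta d0 gap] := spectral_gap_of_simple Ms ss sp k_range k_simple.
have gp : gapped_eigenpair e M f (kth_eigenvalue s k) k delta by split.
have [b bb] : exists b, boundary e f b.
  by apply: exists_boundary => //; [exists v | exists w].
have f_nz : exists v, f v != 0 by exists v.
(* Opposite signs are imposed at the same zero [b], which makes the two signings inequivalent. *)
have [M1 [f1 [d1 [gp1 sg1 f1b]]]] :=
  gapped_signing e_sym e_conn gp f_nz bb (oner_neq0 R).
have N1 : - 1 != 0 :> R by rewrite oppr_eq0 oner_neq0.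
have [M2 [f2 [d2 [gp2 sg2 f2b]]]] :=
  gapped_signing e_sym e_conn gp f_nz bb N1.
have [nz1 _ _] := sg1; have [nz2 _ _] := sg2.
have [[s1 [sp1 l1 si1 ev1]] D1] := gapped_kth_simple e_sym k_range gp1 (ex_intro _ b (nz1 b)).
have [[s2 [sp2 l2 si2 ev2]] D2] := gapped_kth_simple e_sym k_range gp2 (ex_intro _ b (nz2 b)).
have ne12 : ~ equiv_signing f1 f2.
  move/(_ b)/eqP; rewrite f1b f2b sgrN sgr1 eq_sym lt_eqF //.
  by rewrite (lt_trans (ltrN10 R) ltr01).
split; last exact: (UN2_le sg1 sg2 ne12 D1 D2).
exists M1, M2, s1, s2, f1, f2; split; first by split=> //; rewrite ?l1 //; case: gp1.
split; first by split=> //; rewrite ?l2 //; case: gp2.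
by [].
Qed.
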